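(* Let $A\in\mathbb{R}^{n\times n}$, $B\in\mathbb{R}^{n\times p}$, $C\in\mathbb{R}^{p\times n}$, let $\sigma_1,\dots,\sigma_m,\mu_1,\dots,\mu_m\in\mathbb{R}$ be such that all $\sigma_iI_n-A$ and $\mu_iI_n-A$ are invertible, and let $R_1,\dots,R_m,L_1,\dots,L_m\in\mathbb{R}^{p\times s}$. Let $\mathbb{V}_m=[V_1,\dots,V_m]$, $\mathbb{W}_m=[W_1,\dots,W_m]\in\mathbb{R}^{n\times ms}$ be the bi-orthonormal matrices constructed from these data by the Block Tangential Lanczos (BTL) algorithm (described in the context, assumed to run without breakdown), let $\mathbb{G}_m,\mathbb{Q}_m\in\mathbb{R}^{ms\times ms}$ be the associated block upper triangular coefficient matrices (defined in the context), assumed non-singular, and let $\mathbb{R}_m=[R_1,\dots,R_m]$, $\mathbb{L}_m=[L_1,\dots,L_m]$. Put $A_m=\mathbb{W}_m^TA\mathbb{V}_m$, and for $\omega$ such that $\omega I_{ms}-A_m$ is invertible put $$U_m^B(\omega)=(\omega I_{ms}-A_m)^{-1}\mathbb{W}_m^TB,\qquad U_m^C(\omega)=(\omega I_{ms}-A_m)^{-T}\mathbb{V}_m^TC^T,$$ $$R_B(\omega)=B-(\omega I_n-A)\mathbb{V}_mU_m^B(\omega),\qquad R_C(\omega)=C^T-(\omega I_n-A)^T\mathbb{W}_mU_m^C(\omega).$$ Then $$R_B(\omega)=(I_n-\mathbb{V}_m\mathbb{W}_m^T)B\left[I_p-\mathbb{R}_m\mathbb{G}_m^{-1}U_m^B(\omega)\right]$$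 and $$R_C(\omega)=(I_n-\mathbb{W}_m\mathbb{V}_m^T)C^T\left[I_p-\mathbb{L}_m\mathbb{Q}_m^{-1}U_m^C(\omega)\right].$$
   Context: Here $s\le p$, and $M^{-T}$ denotes $(M^{-1})^T$. All blocks $V_i,W_i$ lie in $\mathbb{R}^{n\times s}$. ''Bi-orthonormal'' means $W_i^TV_j=I_s$ if $i=j$ and $W_i^TV_j=0$ if $i\ne j$. Block Tangential Lanczos (BTL) algorithm with inputs $A,B,C,\{\sigma_i\}_{i=1}^{m},\{\mu_i\}_{i=1}^{m},\{R_i\}_{i=1}^{m},\{L_i\}_{i=1}^{m}$: Initialization: compute factorizations $(\sigma_1I_n-A)^{-1}BR_1=V_1H_{1,0}$ and $(\mu_1I_n-A)^{-T}C^TL_1=W_1F_{1,0}$ with $V_1,W_1\in\mathbb{R}^{n\times s}$, $H_{1,0},F_{1,0}\in\mathbb{R}^{s\times s}$ and $W_1^TV_1=I_s$. For $j=1,\dots,m-1$: 1. Set $\widetilde V_{j+1}=(\sigma_{j+1}I_n-A)^{-1}BR_{j+1}$ and $\widetilde W_{j+1}=(\mu_{j+1}I_n-A)^{-T}C^TL_{j+1}$. 2. For $i=1,\dots,j$ successively: $H_{i,j}=W_i^T\widetilde V_{j+1}$, $F_{i,j}=V_i^T\widetilde W_{j+1}$; then update $\widetilde V_{j+1}\leftarrow\widetilde V_{j+1}-V_iH_{i,j}$, $\widetilde W_{j+1}\leftarrow\widetilde W_{j+1}-W_iF_{i,j}$. 3. Compute (thin) QR decompositions $\widetilde V_{j+1}=V_{j+1}H_{j+1,j}$,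 $\widetilde W_{j+1}=W_{j+1}F_{j+1,j}$. 4. Compute the singular value decomposition $W_{j+1}^TV_{j+1}=P_{j+1}D_{j+1}Q_{j+1}^T$ (the diagonal matrix $D_{j+1}$ is assumed invertible, i.e. no breakdown). 5. Update $V_{j+1}\leftarrow V_{j+1}Q_{j+1}D_{j+1}^{-1/2}$, $W_{j+1}\leftarrow W_{j+1}P_{j+1}D_{j+1}^{-1/2}$, $H_{j+1,j}\leftarrow D_{j+1}^{1/2}Q_{j+1}^TH_{j+1,j}$, $F_{j+1,j}\leftarrow D_{j+1}^{1/2}P_{j+1}^TF_{j+1,j}$. The output is $\mathbb{V}_m=[V_1,\dots,V_m]$, $\mathbb{W}_m=[W_1,\dots,W_m]$, where $V_j,W_j,H_{i,j},F_{i,j}$ denote the final values. Coefficient matrices: $\mathbb{G}_m$ (resp. $\mathbb{Q}_m$) is the $ms\times ms$ block upper triangular matrix whose $(j+1)$-th block column, $j=0,\dots,m-1$, consists of the blocks $H_{1,j},\dots,H_{j+1,j}$ (resp. $F_{1,j},\dots,F_{j+1,j}$) stacked vertically, followed by a zero block of size $(m-1-j)s\times s$. *)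

(* Defs.v *)
From mathcomp Require Export all_boot all_order all_algebra.
From mathcomp Require Export reals.
From mathcomp Require Export complex.

Set Implicit Arguments.
Unset Strict Implicit.
Unset Printing Implicit Defensive.

Import Order.TTheory GRing.Theory Num.Theory.
Local Open Scope ring_scope.

(* Block indices are 0-based and live in 'I_m: V k, W k, sigma k, ... stand for
   V_{k+1}, W_{k+1}, sigma_{k+1}, ..., while H i k and F i k stand for
   H_{i+1,k} and F_{i+1,k}. The k-th block column is thus H 0 k, ..., H k k,
   and the entries H i k with i > k are irrelevant. *)

(* No sign condition is imposed on the diagonal of T. *)
Definition is_thin_qr (R : realType) (n s : nat)
    (M Q : 'M[R]_(n, s)) (T : 'M[R]_s) : Prop :=
  [/\ M = Q *m T, Q^T *m Q = 1%:M & is_trig_mx T^T].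

(* The singular values d are not required to be sorted. *)
Definition is_svd (R : realType) (s : nat)
    (M P : 'M[R]_s) (d : 'rV[R]_s) (Q : 'M[R]_s) : Prop :=
  [/\ M = P *m diag_mx d *m Q^T,
      P^T *m P = 1%:M, Q^T *m Q = 1%:M
    & forall i, 0 <= d 0 i].

(* D^{1/2} for D = diag_mx d. *)
Definition diag_sqrt (R : realType) (s : nat) (d : 'rV[R]_s) : 'M[R]_s :=
  diag_mx (map_mx Num.sqrt d).

(* The sweep "for i < k: h_i = W_i^T X; X <- X - V_i h_i", from X to Y.
   T i is the value of the updated matrix before the i-th update. *)
Definition biorth_sweep (R : realType) (n s m : nat)
    (V W : 'I_m -> 'M[R]_(n, s)) (k : 'I_m)
    (X : 'M[R]_(n, s)) (h : 'I_m -> 'M[R]_s) (Y : 'M[R]_(n, s)) : Prop :=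
  exists T : nat -> 'M[R]_(n, s),
    [/\ T 0%N = X,
        forall i : 'I_m, (i < k)%N ->
          h i = (W i)^T *m T i /\ T i.+1 = T i - V i *m h i
      & T k = Y].

Definition btl_init (R : realType) (n s m : nat)
    (X Y : 'I_m -> 'M[R]_(n, s)) (V W : 'I_m -> 'M[R]_(n, s))
    (H F : 'I_m -> 'I_m -> 'M[R]_s) (k : 'I_m) : Prop :=
  [/\ X k = V k *m H k k, Y k = W k *m F k k & (W k)^T *m V k = 1%:M].

Definition btl_step (R : realType) (n s m : nat)
    (X Y : 'I_m -> 'M[R]_(n, s)) (V W : 'I_m -> 'M[R]_(n, s))
    (H F : 'I_m -> 'I_m -> 'M[R]_s) (k : 'I_m) : Prop :=
  exists (Vt Wt Vq Wq : 'M[R]_(n, s)) (Hq Fq : 'M[R]_s)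
         (P Q : 'M[R]_s) (d : 'rV[R]_s),
    [/\ biorth_sweep V W k (X k) (fun i => H i k) Vt
          /\ biorth_sweep W V k (Y k) (fun i => F i k) Wt,
        is_thin_qr Vt Vq Hq /\ is_thin_qr Wt Wq Fq,
        is_svd (Wq^T *m Vq) P d Q /\ diag_mx d \in unitmx,
        V k = Vq *m Q *m invmx (diag_sqrt d)
          /\ W k = Wq *m P *m invmx (diag_sqrt d)
      & H k k = diag_sqrt d *m Q^T *m Hq
          /\ F k k = diag_sqrt d *m P^T *m Fq].

(* V, W, H, F are the final values of a breakdown-free run. This is a relation
   because the factorizations used by the algorithm are not unique. *)
Definition btl_run (R : realType) (n p s m : nat)
    (A : 'M[R]_n) (B : 'M[R]_(n, p)) (C : 'M[R]_(p, n))
    (sigma mu : 'I_m -> R) (Rt Lt : 'I_m -> 'M[R]_(p, s))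
    (V W : 'I_m -> 'M[R]_(n, s)) (H F : 'I_m -> 'I_m -> 'M[R]_s) : Prop :=
  let X k := invmx ((sigma k)%:M - A) *m B *m Rt k in
  let Y k := (invmx ((mu k)%:M - A))^T *m C^T *m Lt k in
  forall k : 'I_m,
    if val k == 0%N then btl_init X Y V W H F k else btl_step X Y V W H F k.

Definition btl_coef (R : realType) (s m : nat)
    (H : 'I_m -> 'I_m -> 'M[R]_s) : 'M[R]_(\sum_(i < m) s) :=
  \mxblock_(i < m, j < m) (if (i <= j)%N then H i j else 0).

(* The data are real but the frequency omega ranges over the complex numbers, so
   the residual identities are read over R[i]; real frequencies are included.
   Transposes stay plain (never conjugated). *)
Definition cmx (R : realType) (a b : nat) (M : 'M[R]_(a, b)) : 'M[R[i]]_(a, b) :=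
  map_mx (real_complex R) M.

Section Residuals.
Variables (K : fieldType) (n p N : nat).
Variables (A : 'M[K]_n) (B : 'M[K]_(n, p)) (C : 'M[K]_(p, n)).
Variables (V W : 'M[K]_(n, N)) (w : K).

Definition proj_mx_A : 'M[K]_N := W^T *m A *m V.

Definition UB : 'M[K]_(N, p) := invmx (w%:M - proj_mx_A) *m W^T *m B.

Definition UC : 'M[K]_(N, p) := (invmx (w%:M - proj_mx_A))^T *m V^T *m C^T.

Definition resB : 'M[K]_(n, p) := B - (w%:M - A) *m V *m UB.

Definition resC : 'M[K]_(n, p) := C^T - (w%:M - A)^T *m W *m UC.
End Residuals.

(* Main.v *)
Require Import Defs.

Set Implicit Arguments.
Unset Strict Implicit.
Unset Printing Implicit Defensive.

Import Order.TTheory GRing.Theory Num.Theory.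
Local Open Scope ring_scope.

(** Write V, W, G for the concatenated bases and the coefficient matrix, S for
    the block diagonal matrix of the shifts.  A sweep only subtracts
    combinations of earlier basis blocks, recorded in H, so the solution blocks
    X_k = (sigma_k I - A)^-1 B R_k are recovered as [X_1 .. X_m] = V G
    ([btl_expansion]).  Multiplying block column k by sigma_k I - A gives the Sylvester equation
      A V G = V G S - B R  ([sylvester_of_expansion]).
    With K = R G^-1 this reads A V = V (G S G^-1) - B K, and when W^T V = I it
    makes the defect of the Galerkin projection A_m = W^T A V equal to
      A V - V A_m = - (I - V W^T) B K.
    Hence B - (w I - A) V U = B - V (w I - A_m) U - (I - V W^T) B K U, and
    (w I - A_m) U = W^T B collects everything behind the projector
    I - V W^T ([galerkin_residual]).

    The point that needs care is bi-orthonormality: a sweep only makes the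
    unnormalised block V_k H_kk orthogonal to the earlier W_i.  Cancelling H_kk
    requires it to be invertible, which is a consequence of the nonsingularity of
    the block triangular matrix G ([block_upper_diag_unitmx]).

    The identity for R_C is the one for R_B with A, B, V, W replaced by
    A^T, C^T, W, V; the algorithm is symmetric under this exchange, so the residual
    formula is proved for one side only ([btl_residual], [resC_tr]). *)

(** * Block matrices *)

Lemma scalar_mxblock (K : pzSemiRingType) (s m : nat) :
  \mxblock_(i < m, j < m) (if i == j then 1%:M else 0 : 'M[K]_s) = 1%:M.
Proof.
rewrite -mxdiagZ /mxdiag; apply/eq_mxblockP => i j.
by case: eqP => // _; rewrite conform_mx_id.
Qed.

(** If N is the inverse of G, downward induction on k shows that block row k of
    N vanishes left of the diagonal: in (G N)_kj with j <= k only the term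
    G_kk N_kj survives.  The case j = k then exhibits N_kk as the inverse of
    G_kk. *)
Lemma block_upper_diag_unitmx (R : realType) (s m : nat)
    (H : 'I_m -> 'I_m -> 'M[R]_s) :
  btl_coef H \in unitmx -> forall k, H k k \in unitmx.
Proof.
move=> Gu; pose N := submxblock (invmx (btl_coef H)).
have GN (i j : 'I_m) : \sum_(l < m) (if (i <= l)%N then H i l else 0) *m N l j
              = if i == j then 1%:M else 0.
  have := mulmxV Gu; rewrite -scalar_mxblock.
  rewrite -[invmx _]submxblockK mul_mxblock => /eq_mxblockP; exact.
suff N_low d (k : 'I_m) : (m - k <= d)%N ->
    H k k *m N k k = 1%:M /\ forall j : 'I_m, (j < k)%N -> N k j = 0.
  by move=> k; have [/mulmx1_unit[]] := N_low _ k (leqnn _).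
elim: d k => [|d IHd] k le_d.
  by move: le_d; rewrite leqn0 subn_eq0 leqNgt ltn_ord.
have Hk (j : 'I_m) : (j <= k)%N ->
    H k k *m N k j = if k == j then 1%:M else 0.
  move=> le_jk; rewrite -GN (bigD1 k) //= leqnn big1 ?addr0 // => l ne_lk.
  case: leqP => [le_kl|_]; last by rewrite mul0mx.
  have lt_kl : (k < l)%N by rewrite ltn_neqAle eq_sym ne_lk.
  have [|_ Nl0] := IHd l; last by rewrite Nl0 ?mulmx0 ?(leq_ltn_trans le_jk).
  by rewrite -ltnS (leq_trans _ le_d) // ltn_sub2l.
have Hk1 := Hk k (leqnn _); rewrite eqxx in Hk1.
split=> // j lt_jk; have [Hu _] := mulmx1_unit Hk1.
have := Hk j (ltnW lt_jk); case: eqP => [e|_ e]; first by rewrite e ltnn in lt_jk.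
by rewrite -(mulKmx Hu (N k j)) e mulmx0.
Qed.

(** * The sweep and the normalisation *)

Lemma biorth_sweep_expansion (R : realType) (n s m : nat)
    (V W : 'I_m -> 'M[R]_(n, s)) (k : 'I_m) X h Y :
  biorth_sweep V W k X h Y ->
  X = \sum_(i < m | (i < k)%N) V i *m h i + Y.
Proof.
case=> T [T0 TS <-].
suff TE j : (j <= k)%N -> X = \sum_(i < m | (i < j)%N) V i *m h i + T j.
  exact: TE.
elim: j => [_|j IHj lt_jk]; first by rewrite big_pred0 // add0r.
have lt_jm := ltn_trans lt_jk (ltn_ord k).
have [_ /= TSj] := TS (Ordinal lt_jm) lt_jk.
rewrite (bigD1 (Ordinal lt_jm)) ?ltnSn //= TSj.
rewrite {1}(IHj (ltnW lt_jk)) [RHS]addrC [RHS]addrA subrK [LHS]addrC.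
congr (_ + _); apply: eq_bigl => i.
by rewrite ltnS -val_eqE /= andbC ltn_neqAle.
Qed.

(** Updates after the i-th one do not destroy orthogonality to W_i because the
    earlier blocks are already bi-orthogonal. *)
Lemma biorth_sweep_orthogonal (R : realType) (n s m : nat)
    (V W : 'I_m -> 'M[R]_(n, s)) (k : 'I_m) X h Y :
  (forall i j : 'I_m, (i < k)%N -> (j < k)%N ->
     (W i)^T *m V j = if i == j then 1%:M else 0) ->
  biorth_sweep V W k X h Y ->
  forall i : 'I_m, (i < k)%N -> (W i)^T *m Y = 0.
Proof.
move=> WV [T [_ TS <-]].
suff WT j : (j <= k)%N -> forall i : 'I_m, (i < j)%N -> (W i)^T *m T j = 0.
  exact: WT.
elim: j => // j IHj lt_jk i lt_ij.
have lt_jm := ltn_trans lt_jk (ltn_ord k); pose j' := Ordinal lt_jm.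
have [/= hj TSj] := TS j' lt_jk; rewrite TSj mulmxBr mulmxA WV //; last first.
  exact: leq_trans lt_ij lt_jk.
case: eqP => [->|/eqP ne_ij]; first by rewrite mul1mx hj subrr.
rewrite mul0mx subr0 IHj ?(ltnW lt_jk) //.
rewrite ltn_neqAle -ltnS lt_ij andbT; apply: contra ne_ij => /eqP ij.
exact/eqP/val_inj.
Qed.

Lemma diag_sqrt_sqr (R : realType) (s : nat) (d : 'rV[R]_s) :
  (forall i, 0 <= d 0 i) -> diag_sqrt d *m diag_sqrt d = diag_mx d.
Proof.
move=> d_ge0; rewrite /diag_sqrt mulmx_diag; congr diag_mx.
by apply/rowP => i; rewrite !mxE -expr2 sqr_sqrtr.
Qed.

(** The first block and every later step look alike from outside: the final block
    V_k H_kk is the swept block, and V_k, W_k are normalised against each other. *)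
Lemma btl_step_sweep (R : realType) (n s m : nat)
    (X Y V W : 'I_m -> 'M[R]_(n, s)) (H F : 'I_m -> 'I_m -> 'M[R]_s) k :
  btl_step X Y V W H F k ->
  [/\ biorth_sweep V W k (X k) (H^~ k) (V k *m H k k),
      biorth_sweep W V k (Y k) (F^~ k) (W k *m F k k)
    & (W k)^T *m V k = 1%:M].
Proof.
case=> Vt [Wt [Vq [Wq [Hq [Fq [P [Q [d]]]]]]]].
case=> -[sV sW] [[VtE _ _] [WtE _ _]] [[svdE PP QQ d_ge0] du] [-> ->] [-> ->].
have dd := diag_sqrt_sqr d_ge0.
have qu : diag_sqrt d \in unitmx by move: du; rewrite -dd unitmx_mul andbb.
rewrite !mulmxA !mulmxKV // -!(mulmxA _ _ Q^T) -!(mulmxA _ _ P^T).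
rewrite (mulmx1C QQ) (mulmx1C PP) !mulmx1 -VtE -WtE; split=> //.
have core : P^T *m (Wq^T *m (Vq *m Q)) = diag_mx d.
  by rewrite (mulmxA Wq^T) svdE !mulmxA PP mul1mx -mulmxA QQ mulmx1.
rewrite !trmx_mul trmx_inv [(diag_sqrt d)^T]tr_diag_mx.
transitivity (invmx (diag_sqrt d) *m (P^T *m (Wq^T *m (Vq *m Q)))
              *m invmx (diag_sqrt d)); first by rewrite !mulmxA.
by rewrite core -dd mulmxA mulmxK // mulVmx.
Qed.

Lemma btl_init_sweep (R : realType) (n s m : nat)
    (X Y V W : 'I_m -> 'M[R]_(n, s)) (H F : 'I_m -> 'I_m -> 'M[R]_s) (k : 'I_m) :
  val k = 0%N -> btl_init X Y V W H F k ->
  [/\ biorth_sweep V W k (X k) (H^~ k) (V k *m H k k),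
      biorth_sweep W V k (Y k) (F^~ k) (W k *m F k k)
    & (W k)^T *m V k = 1%:M].
Proof.
move=> k0 [XE YE WV]; split=> //; [exists (fun=> X k) | exists (fun=> Y k)].
  by split=> // i; rewrite k0.
by split=> // i; rewrite k0.
Qed.

Lemma btl_run_sweep (R : realType) (n p s m : nat)
    (A : 'M[R]_n) (B : 'M[R]_(n, p)) (C : 'M[R]_(p, n))
    (sigma mu : 'I_m -> R) (Rt Lt : 'I_m -> 'M[R]_(p, s))
    (V W : 'I_m -> 'M[R]_(n, s)) (H F : 'I_m -> 'I_m -> 'M[R]_s) :
  btl_run A B C sigma mu Rt Lt V W H F ->
  let X k := invmx ((sigma k)%:M - A) *m B *m Rt k in
  let Y k := invmx ((mu k)%:M - A^T) *m C^T *m Lt k in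
  forall k : 'I_m,
  [/\ biorth_sweep V W k (X k) (H^~ k) (V k *m H k k),
      biorth_sweep W V k (Y k) (F^~ k) (W k *m F k k)
    & (W k)^T *m V k = 1%:M].
Proof.
move=> run X Y k.
have -> : Y k = (invmx ((mu k)%:M - A))^T *m C^T *m Lt k.
  by rewrite trmx_inv linearB /= tr_scalar_mx.
by have := run k; case: eqP => [k0 /(btl_init_sweep k0)|_ /btl_step_sweep].
Qed.

(** * Bi-orthonormality and expansion of the solution blocks *)

(** Induction over the steps; at step k the sweeps give W_i^T (V_k H_kk) = 0 and
    V_i^T (W_k F_kk) = 0 for i < k, and the invertible factors cancel. *)
Lemma biorthonormal_of_sweeps (R : realType) (n s m : nat)
    (X Y V W : 'I_m -> 'M[R]_(n, s)) (H F : 'I_m -> 'I_m -> 'M[R]_s) :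
  (forall k,
  [/\ biorth_sweep V W k (X k) (H^~ k) (V k *m H k k),
      biorth_sweep W V k (Y k) (F^~ k) (W k *m F k k)
    & (W k)^T *m V k = 1%:M]) ->
  (forall k, H k k \in unitmx) -> (forall k, F k k \in unitmx) ->
  forall i j, (W i)^T *m V j = if i == j then 1%:M else 0.
Proof.
move=> sweeps Hu Fu.
suff WV d (i j : 'I_m) : (i < d)%N -> (j < d)%N ->
    (W i)^T *m V j = if i == j then 1%:M else 0.
  by move=> i j; exact: WV (ltn_ord i) (ltn_ord j).
elim: d i j => // d IHd.
have IHd' (i j : 'I_m) : (i < d)%N -> (j < d)%N ->
    (V i)^T *m W j = if i == j then 1%:M else 0.
  move=> lt_i lt_j; apply: trmx_inj; rewrite trmx_mul trmxK IHd //.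
  by rewrite eq_sym; case: eqP => _; rewrite ?trmx1 ?trmx0.
have new (i k : 'I_m) : (i < d)%N -> k = d :> nat ->
    (W i)^T *m V k = 0 /\ (V i)^T *m W k = 0.
  move=> lt_id kd; have [sV sW _] := sweeps k; rewrite -kd in IHd IHd' lt_id.
  split.
    rewrite -[LHS](mulmxK (Hu k)) -(mulmxA (W i)^T).
    by rewrite (biorth_sweep_orthogonal IHd sV) // mul0mx.
  rewrite -[LHS](mulmxK (Fu k)) -(mulmxA (V i)^T).
  by rewrite (biorth_sweep_orthogonal IHd' sW) // mul0mx.
move=> i j; rewrite !ltnS (leq_eqVlt i) (leq_eqVlt j).
case/predU1P=> [id | lt_i] /predU1P[jd | lt_j]; last exact: IHd.
- have -> : j = i by apply: val_inj; rewrite /= id.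
  by have [_ _ ->] := sweeps i; rewrite eqxx.
- have [_ /(congr1 trmx)] := new j i lt_j id.
  rewrite trmx_mul trmxK trmx0 => ->; case: eqP => // e.
  by move: lt_j; rewrite -e id ltnn.
- have [-> _] := new i j lt_i jd; case: eqP => // e.
  by move: lt_i; rewrite e jd ltnn.
Qed.

Lemma btl_expansion (R : realType) (n s m : nat)
    (X V W : 'I_m -> 'M[R]_(n, s)) (H : 'I_m -> 'I_m -> 'M[R]_s) :
  (forall k, biorth_sweep V W k (X k) (H^~ k) (V k *m H k k)) ->
  \mxrow_(j < m) X j = \mxrow_(j < m) V j *m btl_coef H.
Proof.
move=> sweeps; rewrite mul_mxrow_mxblock; apply/eq_mxrowP => k.
rewrite (biorth_sweep_expansion (sweeps k)) [RHS](bigD1 k) //= leqnn addrC.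
congr (_ + _); rewrite big_mkcond [RHS]big_mkcond /=; apply: eq_bigr => i _.
rewrite ltn_neqAle -val_eqE /=; case: eqP => //= _.
by case: leqP; rewrite ?mulmx0.
Qed.

(** * Sylvester equation and residual *)

Lemma sylvester_of_expansion (R : realType) (n p s m : nat)
    (A : 'M[R]_n) (B : 'M[R]_(n, p)) (sigma : 'I_m -> R)
    (Rt : 'I_m -> 'M[R]_(p, s)) N (V : 'M[R]_(n, N)) G :
  (forall i, (sigma i)%:M - A \in unitmx) ->
  \mxrow_(k < m) (invmx ((sigma k)%:M - A) *m B *m Rt k) = V *m G ->
  A *m V *m G = V *m G *m \mxdiag_(k < m) (sigma k)%:M
                - B *m \mxrow_(k < m) Rt k.
Proof.
move=> su E; rewrite -mulmxA -E mul_mxrow mul_mxrow_mxdiag mul_mxrow -mxrowB.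
apply/eq_mxrowP => k; rewrite mul_mx_scalar -{3}[B](mulKVmx (su k)) -!mulmxA.
by rewrite mulmxBl mul_scalar_mx subKr.
Qed.

(** The whole algebraic content of the residual formula, over any field: a
    Sylvester equation with an arbitrary right factor S plus W^T V = I. *)
Lemma galerkin_residual (K : fieldType) (n p N : nat)
    (A : 'M[K]_n) (B : 'M[K]_(n, p)) (V W : 'M[K]_(n, N)) (G S : 'M[K]_N)
    (Rt : 'M[K]_(p, N)) (w : K) :
  W^T *m V = 1%:M -> G \in unitmx ->
  A *m V *m G = V *m G *m S - B *m Rt ->
  w%:M - proj_mx_A A V W \in unitmx ->
  resB A B V W w =
    (1%:M - V *m W^T) *m B *m (1%:M - Rt *m invmx G *m UB A B V W w).
Proof.
move=> WV Gu sylv wu; rewrite /resB; set U := UB _ _ _ _ _.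
have UE : (w%:M - proj_mx_A A V W) *m U = W^T *m B.
  by rewrite /U /UB -mulmxA mulKVmx.
pose Z := G *m S *m invmx G.
have AV : A *m V = V *m Z - B *m (Rt *m invmx G).
  by rewrite -[LHS](mulmxK Gu) sylv mulmxBl /Z !mulmxA.
have Am : proj_mx_A A V W = Z - W^T *m B *m (Rt *m invmx G).
  by rewrite /proj_mx_A -mulmxA AV mulmxBr !mulmxA WV mul1mx.
have defect : A *m V - V *m proj_mx_A A V W
              = - ((1%:M - V *m W^T) *m B *m (Rt *m invmx G)).
  rewrite AV Am mulmxBr opprB addrC addrA subrK.
  by rewrite !mulmxBl mul1mx opprB !mulmxA.
have split_shift : (w%:M - A) *m V
    = V *m (w%:M - proj_mx_A A V W) - (A *m V - V *m proj_mx_A A V W).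
  by rewrite mulmxBl mulmxBr mul_scalar_mx mul_mx_scalar opprB addrA subrK.
rewrite split_shift defect opprK mulmxDl -(mulmxA V) UE mulmxBr mulmx1 !mulmxA.
by rewrite opprD addrA (mulmxBl _ _ B) mul1mx.
Qed.

(** Only the resolvent of A_m involves the complex frequency: bi-orthonormality
    and the Sylvester equation are real identities, transported to R[i]
    entrywise before the residual formula is applied. *)
Lemma btl_residual (R : realType) (n p s m : nat)
    (A : 'M[R]_n) (B : 'M[R]_(n, p)) (sigma : 'I_m -> R)
    (Rt : 'I_m -> 'M[R]_(p, s)) (V W : 'I_m -> 'M[R]_(n, s))
    (H : 'I_m -> 'I_m -> 'M[R]_s) (omega : R[i]) :
  (forall i, (sigma i)%:M - A \in unitmx) ->
  (forall k, biorth_sweep V W k (invmx ((sigma k)%:M - A) *m B *m Rt k)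
               (H^~ k) (V k *m H k k)) ->
  (forall i j, (W i)^T *m V j = if i == j then 1%:M else 0) ->
  btl_coef H \in unitmx ->
  let Ac := cmx A in
  let Bc := cmx B in
  let Vm := cmx (\mxrow_(j < m) V j) in
  let Wm := cmx (\mxrow_(j < m) W j) in
  omega%:M - proj_mx_A Ac Vm Wm \in unitmx ->
  resB Ac Bc Vm Wm omega =
    (1%:M - Vm *m Wm^T) *m Bc
      *m (1%:M - cmx (\mxrow_(j < m) Rt j) *m invmx (cmx (btl_coef H))
                   *m UB Ac Bc Vm Wm omega).
Proof.
move=> su sweeps WV Gu Ac Bc Vm Wm wu.
have sylv := sylvester_of_expansion su (btl_expansion sweeps).
apply: (galerkin_residual (S := cmx (\mxdiag_(k < m) (sigma k)%:M))) => //.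
- rewrite /Vm /Wm /cmx map_trmx -map_mxM tr_mxrow mul_mxcol_mxrow.
  rewrite -(map_mx1 (real_complex R)); congr map_mx; rewrite -scalar_mxblock.
  exact/eq_mxblockP.
- by rewrite map_unitmx.
- by rewrite /Ac /Bc /Vm /cmx -!map_mxM sylv map_mxB.
Qed.

Lemma resC_tr (K : fieldType) (n p N : nat) (A : 'M[K]_n) (C : 'M[K]_(p, n))
    (V W : 'M[K]_(n, N)) (w : K) :
  [/\ (w%:M - proj_mx_A A V W)^T = w%:M - proj_mx_A A^T W V,
      UC A C V W w = UB A^T C^T W V w
    & resC A C V W w = resB A^T C^T W V w].
Proof.
have projT : (w%:M - proj_mx_A A V W)^T = w%:M - proj_mx_A A^T W V.
  by rewrite linearB /= tr_scalar_mx /proj_mx_A !trmx_mul trmxK mulmxA.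
have UT : UC A C V W w = UB A^T C^T W V w.
  by rewrite /UC /UB trmx_inv projT.
by split=> //; rewrite /resC /resB UT linearB /= tr_scalar_mx.
Qed.

Theorem proposition4p1 (R : realType) (n p s m : nat)
    (A : 'M[R]_n) (B : 'M[R]_(n, p)) (C : 'M[R]_(p, n))
    (sigma mu : 'I_m -> R) (Rt Lt : 'I_m -> 'M[R]_(p, s))
    (V W : 'I_m -> 'M[R]_(n, s)) (H F : 'I_m -> 'I_m -> 'M[R]_s)
    (omega : R[i]) :
  (s <= p)%N ->
  (forall i, (sigma i)%:M - A \in unitmx) ->
  (forall i, (mu i)%:M - A \in unitmx) ->
  btl_run A B C sigma mu Rt Lt V W H F ->
  btl_coef H \in unitmx ->
  btl_coef F \in unitmx ->
  let Ac := cmx A in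
  let Bc := cmx B in
  let Cc := cmx C in
  let Vm := cmx (\mxrow_(j < m) V j) in
  let Wm := cmx (\mxrow_(j < m) W j) in
  let Rm := cmx (\mxrow_(j < m) Rt j) in
  let Lm := cmx (\mxrow_(j < m) Lt j) in
  let Gm := cmx (btl_coef H) in
  let Qm := cmx (btl_coef F) in
  omega%:M - proj_mx_A Ac Vm Wm \in unitmx ->
  resB Ac Bc Vm Wm omega =
    (1%:M - Vm *m Wm^T) *m Bc
      *m (1%:M - Rm *m invmx Gm *m UB Ac Bc Vm Wm omega)
  /\
  resC Ac Cc Vm Wm omega =
    (1%:M - Wm *m Vm^T) *m Cc^T
      *m (1%:M - Lm *m invmx Qm *m UC Ac Cc Vm Wm omega).
Proof.
move=> _ su mu_u run Gu Qu Ac Bc Cc Vm Wm Rm Lm Gm Qm wu.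
have sweeps := btl_run_sweep run.
have WV := biorthonormal_of_sweeps sweeps
  (block_upper_diag_unitmx Gu) (block_upper_diag_unitmx Qu).
split; first by apply: (btl_residual (sigma := sigma)) => // k; have [] := sweeps k.
have [projT UT ->] := resC_tr Ac Cc Vm Wm omega; rewrite UT.
have cmxT a b (M : 'M[R]_(a, b)) : (cmx M)^T = cmx M^T by rewrite /cmx map_trmx.
rewrite (cmxT _ _ A) (cmxT _ _ C) in projT *.
apply: (btl_residual (A := A^T) (B := C^T) (sigma := mu) (Rt := Lt)
  (V := W) (W := V) (H := F)).
- by move=> i; rewrite -unitmx_tr linearB /= tr_scalar_mx trmxK.
- by move=> k; have [] := sweeps k.
- move=> i j; apply: trmx_inj; rewrite trmx_mul trmxK WV eq_sym.
  by case: eqP => _; rewrite ?trmx1 ?trmx0.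
- exact: Qu.
- by rewrite -projT unitmx_tr.
Qed.
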